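(* Let $n\ge 2$ and $q>2$, and let $S$ be an $n$-window sequence over $\mathbb{Z}_q$ containing no zeros and such that every $n$-tuple appearing in $S$ has weight less than $nq/2$. Then $S$ is a negative orientable sequence of order $n$.
   Context: Sequences are periodic with entries in $\mathbb{Z}_q$. For $S=(s_i)$ write $\mathbf{s}_n(i)=(s_i,\ldots,s_{i+n-1})$; for an $n$-tuple $\mathbf{u}=(u_0,\ldots,u_{n-1})$ let $\mathbf{u}^R=(u_{n-1},\ldots,u_0)$ and $-\mathbf{u}=(-u_0,\ldots,-u_{n-1})$. A periodic sequence of period $m$ is an $n$-window sequence if $\mathbf{s}_n(i)=\mathbf{s}_n(j)$ implies $i\equiv j\pmod m$; it is a negative orientable sequence of order $n$ if also $\mathbf{s}_n(i)\neq-\mathbf{s}_n(j)^R$ for all $i,j$. The weight of an $n$-tuple $(u_0,\ldots,u_{n-1})$ is $\sum_i u_i$ computed in $\mathbb{Z}$, treating each $u_i$ as an integer in $[0,q-1]$. *)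

(* Defs.v *)
From mathcomp Require Import all_boot all_order all_algebra.

Set Implicit Arguments.
Unset Strict Implicit.
Unset Printing Implicit Defensive.

Import GRing.Theory.
Local Open Scope ring_scope.

(* 'Z_q is the ring of integers modulo q only for q > 1. *)

Definition window (q n : nat) (s : nat -> 'Z_q) (i : nat) : n.-tuple 'Z_q :=
  [tuple s (i + k)%N | k < n].

Definition tuple_rev (q n : nat) (u : n.-tuple 'Z_q) : n.-tuple 'Z_q :=
  [tuple of rev u].

Definition tuple_neg (q n : nat) (u : n.-tuple 'Z_q) : n.-tuple 'Z_q :=
  [tuple of [seq - x | x <- u]].

(* The sum is taken in nat: each entry stands for its residue in [0, q - 1]. *)
Definition weight (q n : nat) (u : n.-tuple 'Z_q) : nat :=
  (\sum_(k < n) nat_of_ord (tnth u k))%N.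

Definition periodic (q m : nat) (s : nat -> 'Z_q) : Prop :=
  (0 < m)%N /\ forall i : nat, s (i + m)%N = s i.

(* The window condition forces m to be the least period. *)
Definition window_sequence (q n m : nat) (s : nat -> 'Z_q) : Prop :=
  periodic m s /\
  forall i j : nat, window n s i = window n s j -> i = j %[mod m].

Definition negative_orientable (q n m : nat) (s : nat -> 'Z_q) : Prop :=
  window_sequence n m s /\
  forall i j : nat, window n s i <> tuple_neg (tuple_rev (window n s j)).

(* Main.v *)
(* Negating a nonzero residue x gives q - x, so negating a zero-free n-tuple of
   weight w gives weight nq - w, and reversal preserves weight.  A window equal
   to the reversed negative of another would thus force two windows of weight
   less than nq/2 to have weights summing to nq. *)
Require Import Defs.
From mathcomp Require Import all_boot all_order all_algebra.

Import Order.TTheory GRing.Theory Num.Theory.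

Local Open Scope ring_scope.

(** Puts the weight in the form to which [perm_big] and [big_map] apply. *)
Lemma weightE (q n : nat) (u : n.-tuple 'Z_q) :
  weight u = (\sum_(x <- u) x)%N.
Proof. by rewrite big_tuple. Qed.

Lemma weight_rev (q n : nat) (u : n.-tuple 'Z_q) :
  weight (tuple_rev u) = weight u.
Proof. by rewrite !weightE; apply: perm_big; rewrite perm_rev. Qed.

Lemma val_ZpN_add (q : nat) (x : 'Z_q) :
  (1 < q)%N -> x != 0 -> ((- x)%R + x)%N = q.
Proof.
move=> q_gt1 x_neq0; have x_gt0 : (0 < x)%N by rewrite lt0n.
(* As [x > 0], the modulus minus [x] is already reduced. *)
rewrite /= modn_small; last by rewrite ltn_subrL x_gt0.
by rewrite (subnK (ltnW (ltn_ord x))) Zp_cast.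
Qed.

Lemma weight_neg_add (q n : nat) (u : n.-tuple 'Z_q) :
  (1 < q)%N -> 0 \notin u -> (weight (tuple_neg u) + weight u)%N = (n * q)%N.
Proof.
(* [big_seq] records [x \in u], from which [x != 0] follows. *)
move=> q_gt1 u_nz; rewrite !weightE big_map -big_split big_seq.
rewrite (eq_bigr (fun=> q)) => [|x xu]; last first.
  by apply: val_ZpN_add => //; apply: contraNneq u_nz => <-.
by rewrite -big_seq big_const_seq count_predT size_tuple iter_addn_0 mulnC.
Qed.

Theorem theorem3 (n q m : nat) (s : nat -> 'Z_q)
  (hn : (2 <= n)%N) (hq : (2 < q)%N)
  (hS : window_sequence n m s)
  (hnz : forall i : nat, s i <> 0)
  (hw : forall i : nat, (weight (window n s i))%:R < (n * q)%:R / 2%:R :> rat) :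
  negative_orientable n m s.
Proof.
split=> // i j eq_ij.
have rev_nz : 0 \notin tuple_rev (window n s j).
  by rewrite mem_rev; apply/negP => /mapP[k _ /esym/hnz].
have := ltrD (hw i) (hw j).
(* Passing to the reversed window makes the two tuples exact negatives, so the strict bound becomes
   [n * q < n * q]. *)
rewrite -splitr -natrD -(weight_rev _ _ (window n s j)) eq_ij.
by rewrite weight_neg_add ?ltxx // ltnW.
Qed.
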